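(* Let $R$ be a nonzero associative unital ring, $n$ a positive integer and $G$ a group with identity element $e$. Suppose that $\rho$ is an equivalence relation on $\overline{n}=\{1,\ldots,n\}$ and that $(S_g)_{g\in G}$ is a very good $G$-grading on $M_n(\rho,R)$ with $S_e=D=\bigoplus_{i=1}^nRe_{i,i}$. Then the $G$-graded ring $M_n(\rho,R)$ is an epsilon-crossed product.
   Context: For $X,Y\subseteq\overline{n}\times\overline{n}$ put $XY=\{(i,k)\mid \exists j\in\overline{n}:\ (i,j)\in X,\ (j,k)\in Y\}$. A $G$-grading on $\rho$ is a family $(\rho_g)_{g\in G}$ of pairwise disjoint (possibly empty) subsets of $\rho$ with $\rho=\bigcup_{g\in G}\rho_g$ and $\rho_g\rho_h\subseteq\rho_{gh}$ for all $g,h\in G$. $e_{i,j}$ is the $n\times n$ matrix over $R$ with $1$ in position $(i,j)$ and zeros elsewhere; $M_n(\rho,R)=\sum_{(i,j)\in\rho}Re_{i,j}\subseteq M_n(R)$. A $G$-grading $(S_g)_{g\in G}$ on $M_n(\rho,R)$ is very good if there is a $G$-grading $(\rho_g)_{g\in G}$ on $\rho$ with $S_g=\sum_{(i,j)\in\rho_g}Re_{i,j}$ for all $g\in G$. A $G$-graded unital ring $S=\bigoplus_{g\in G}S_g$ is epsilon-strong if for every $g\in G$ there is $\epsilon_g\in S_gS_{g^{-1}}$ (the additive subgroup generated by products) such that $\epsilon_gs=s\epsilon_{g^{-1}}=s$ for all $g\in G$, $s\in S_g$. It is an epsilon-crossed product if it is epsilon-strong and for every $g\in G$ there are $s_g\in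 S_g$ and $t_{g^{-1}}\in S_{g^{-1}}$ such that $s_gt_{g^{-1}}=\epsilon_g$ and $t_{g^{-1}}s_g=\epsilon_{g^{-1}}$. *)

(* Defs.v *)
From mathcomp Require Import all_boot all_order all_algebra.
From mathcomp Require Import boolp classical_sets functions cardinality fsbigop.

Set Implicit Arguments.
Unset Strict Implicit.
Unset Printing Implicit Defensive.

Import GRing.Theory.
Local Open Scope classical_set_scope.
Local Open Scope ring_scope.

(* Graded rings are internal: A is a unital subring of an ambient ring T (with
   the same 1), and S g is a subset of A for every g in the group G, which may
   be infinite and noncommutative. *)

Definition is_addsubgroup (T : pzRingType) (U : set T) : Prop :=
  U 0 /\ (forall x y, U x -> U y -> U (x - y)).

Definition is_unital_subring (T : pzRingType) (A : set T) : Prop :=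
  [/\ is_addsubgroup A, A 1 & forall x y, A x -> A y -> A (x * y)].

Definition setmul (T : pzRingType) (U V : set T) : set T :=
  [set u * v | u in U & v in V].

(* The product UV of additive subgroups: the additive subgroup generated by
   the elementwise products. *)
Definition addmul (T : pzRingType) (U V : set T) : set T :=
  smallest (@is_addsubgroup T) (setmul U V).

(* In the second clause, A is the direct sum of the S g: every element of A is
   a finitely supported sum of homogeneous elements, in a unique way. *)
Definition is_grading (G : groupType) (T : pzRingType)
    (A : set T) (S : G -> set T) : Prop :=
  [/\ forall g, is_addsubgroup (S g) /\ S g `<=` A,
      forall x, A x -> exists! f : G -> T,
        [/\ forall g, S g (f g), finite_set [set g | f g <> 0]
          & x = \sum_(g \in [set: G]) f g]
    & forall g h, addmul (S g) (S h) `<=` S (g * h)%g].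

Definition is_epsilon_family (G : groupType) (T : pzRingType)
    (S : G -> set T) (eps : G -> T) : Prop :=
  (forall g, addmul (S g) (S (g^-1)%g) (eps g)) /\
  (forall g s, S g s -> eps g * s = s /\ s * eps (g^-1)%g = s).

(* A family eps as above is uniquely determined by S: eps g is the only element
   of S_g S_{g^-1} acting as a left identity on S_g and as a right identity on
   S_{g^-1}.  So it does not matter which one is used in the second part. *)
Definition is_epsilon_crossed_product (G : groupType) (T : pzRingType)
    (A : set T) (S : G -> set T) : Prop :=
  [/\ is_unital_subring A, is_grading A S
    & exists eps : G -> T, is_epsilon_family S eps /\
        forall g, exists s t : T,
          [/\ S g s, S (g^-1)%g t, s * t = eps g & t * s = eps (g^-1)%g]].

Definition is_equiv_on (n : nat) (rho : {set 'I_n * 'I_n}) : Prop :=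
  let r : rel 'I_n := fun i j => (i, j) \in rho in
  [/\ reflexive r, symmetric r & transitive r].

Definition relmul (n : nat) (X Y : {set 'I_n * 'I_n}) : {set 'I_n * 'I_n} :=
  [set p | [exists j, ((p.1, j) \in X) && ((j, p.2) \in Y)]]%SET.

Definition is_rel_grading (G : groupType) (n : nat)
    (rho : {set 'I_n * 'I_n}) (rho_ : G -> {set 'I_n * 'I_n}) : Prop :=
  [/\ forall g h, g != h -> [disjoint rho_ g & rho_ h]%B,
      forall p, p \in rho <-> exists g, p \in rho_ g
    & forall g h, relmul (rho_ g) (rho_ h) \subset rho_ (g * h)%g].

(* The left R-span of the matrix units indexed by X; it is M_n(rho, R) when
   X = rho. *)
Definition relmx (R : nzRingType) (n : nat) (X : {set 'I_n * 'I_n}) :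
    set 'M[R]_n :=
  [set \sum_(p in X) c p *: delta_mx p.1 p.2 | c in [set: 'I_n * 'I_n -> R]].
Arguments relmx R {n} X.

Definition diagmx (R : nzRingType) (n : nat) : set 'M[R]_n :=
  [set \sum_(i < n) c i *: delta_mx i i | c in [set: 'I_n -> R]].
Arguments diagmx : clear implicits.

Definition is_very_good_grading (G : groupType) (R : nzRingType) (n : nat)
    (rho : {set 'I_n * 'I_n}) (S : G -> set 'M[R]_n) : Prop :=
  is_grading (relmx R rho) S /\
  exists rho_ : G -> {set 'I_n * 'I_n},
    is_rel_grading rho rho_ /\ forall g, S g = relmx R (rho_ g).

(* Main.v *)
(* Writing rho_g for the support of S_g, the hypothesis S_e = D says that rho_e
   is the diagonal.  Since rho is an equivalence relation, (i, j) in rho_g forces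
   (j, i) in rho_{g^-1}, as (i, j)(j, i) = (i, i) lies in rho_e; two entries of
   rho_g in the same row (or column) then compose with such an inverse to an
   entry of rho_e, so they coincide.  Hence rho_g is a partial bijection with
   inverse rho_{g^-1}.  The 0-1 matrices s_g of rho_g are thus partial
   permutation matrices, and eps_g = s_g s_{g^-1}, s = s_g, t = s_{g^-1} work. *)
Require Import Defs.
From mathcomp Require Import all_boot all_order all_algebra.
From mathcomp Require Import boolp classical_sets functions cardinality fsbigop.

Set Implicit Arguments.
Unset Strict Implicit.
Unset Printing Implicit Defensive.

Import GRing.Theory.
Local Open Scope ring_scope.

Section RelationMatrices.
Variables (R : nzRingType) (n : nat).
Implicit Types (X : {set 'I_n * 'I_n}) (M : 'M[R]_n).

Lemma relmxE X (c : 'I_n * 'I_n -> R) i j :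
  (\sum_(p in X) c p *: delta_mx p.1 p.2 : 'M[R]_n) i j =
  if (i, j) \in X then c (i, j) else 0.
Proof.
rewrite summxE; under eq_bigr => p _ do rewrite !mxE.
have off (p : 'I_n * 'I_n) : p != (i, j) ->
    c p * ((i == p.1) && (j == p.2))%:R = 0.
  case: p => a b; rewrite xpair_eqE /= ![_ == i]eq_sym ![_ == j]eq_sym.
  by move=> /negbTE ->; rewrite mulr0.
case: ifPn => ij_X.
  rewrite (bigD1 (i, j)) //= !eqxx mulr1 big1 ?addr0 // => p /andP[_].
  exact: off.
apply: big1 => p pX; apply: off; apply: contraNneq ij_X => <-.
exact: pX.
Qed.

(** Each coefficient of the span is an entry of [M], so membership becomes a vanishing condition;
    later membership goals are settled in this form. *)
Lemma relmxP X M : relmx R X M <-> forall i j, (i, j) \notin X -> M i j = 0.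
Proof.
split=> [[c _ <-] i j /negbTE ijX|M0]; first by rewrite relmxE ijX.
exists (fun p => M p.1 p.2) => //; apply/matrixP => i j; rewrite relmxE.
by case: ifPn => // /M0.
Qed.

Lemma diagmxP M : diagmx R n M <-> forall i j, i != j -> M i j = 0.
Proof.
have dE (c : 'I_n -> R) : \sum_(i < n) c i *: delta_mx i i = diag_mx (\row_i c i).
  rewrite diag_mx_sum_delta; apply: eq_bigr => i _.
  by rewrite mxE.
split=> [[c _ <-] i j /negbTE ij|M0].
  by rewrite dE !mxE ij mulr0n.
exists (fun i => M i i) => //; rewrite dE; apply/matrixP => i j; rewrite !mxE.
by case: eqP => [->|/eqP /M0 ->]; rewrite ?mulr1n ?mulr0n.
Qed.

Definition relind X : 'M[R]_n := \matrix_(i, j) ((i, j) \in X)%:R.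

Lemma relmx_relind X : relmx R X (relind X).
Proof. by apply/relmxP => i j /negbTE ijX; rewrite mxE ijX. Qed.

(** Only [l = k] survives in the sum: left multiplication by [relind X] copies row [k] of [M] into
    row [i]. *)
Lemma relind_mull X M i k j :
    (forall l, (i, l) \in X -> l = k) -> (i, k) \in X ->
  (relind X *m M) i j = M k j.
Proof.
move=> uniqX ikX; rewrite mxE (bigD1 k) //= mxE ikX mul1r big1 ?addr0 // => l lk.
have /negbTE lX : (i, l) \notin X by apply: contra lk => /uniqX ->.
by rewrite mxE lX mul0r.
Qed.

Lemma relind_mulr X M i k j :
    (forall l, (l, j) \in X -> l = k) -> (k, j) \in X ->
  (M *m relind X) i j = M i k.
Proof.
move=> uniqX kjX; rewrite mxE (bigD1 k) //= mxE kjX mulr1 big1 ?addr0 // => l lk.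
have /negbTE lX : (l, j) \notin X by apply: contra lk => /uniqX ->.
by rewrite mxE lX mulr0.
Qed.

Lemma relind_mull0 X M i j :
  (forall l, (i, l) \notin X) -> (relind X *m M) i j = 0.
Proof.
by move=> X0; rewrite mxE big1 // => l _; rewrite mxE (negbTE (X0 l)) mul0r.
Qed.

Lemma relind_mulr0 X M i j :
  (forall l, (l, j) \notin X) -> (M *m relind X) i j = 0.
Proof.
by move=> X0; rewrite mxE big1 // => l _; rewrite mxE (negbTE (X0 l)) mulr0.
Qed.

(** Reflexivity accounts for the unit. For products, if [(i, j)] is outside [X], transitivity makes
    one factor of [M i k * N k j] vanish for each [k]. *)
Lemma relmx_unital_subring X :
  is_equiv_on X -> is_unital_subring (relmx R X).
Proof.
move=> [Xrefl _ Xtrans]; split.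
- split; first by apply/relmxP => i j _; rewrite mxE.
  move=> M N /relmxP M0 /relmxP N0; apply/relmxP => i j ijX.
  by rewrite !mxE M0 // N0 // subr0.
- apply/relmxP => i j ijX; rewrite mxE; case: eqP ijX => // ->.
  by rewrite Xrefl.
move=> M N /relmxP M0 /relmxP N0; apply/relmxP => i j ijX.
rewrite mxE big1 // => k _.
have [ikX|/M0 ->] := boolP ((i, k) \in X); last by rewrite mul0r.
rewrite N0 ?mulr0 //; apply: contra ijX; exact: Xtrans ikX.
Qed.

End RelationMatrices.

Section PartialBijections.
Variables (G : groupType) (n : nat) (rho : {set 'I_n * 'I_n}).
Variable rho_ : G -> {set 'I_n * 'I_n}.
Hypotheses (rho_equiv : is_equiv_on rho) (rho_gr : is_rel_grading rho rho_).
Hypothesis rho_1 : forall i j, ((i, j) \in rho_ 1%g) = (i == j).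

Lemma rel_grading_mul g h i j k :
  (i, j) \in rho_ g -> (j, k) \in rho_ h -> (i, k) \in rho_ (g * h)%g.
Proof.
case: rho_gr => _ _ rhoM ij jk; apply: (fintype.subsetP (rhoM g h)).
by rewrite inE; apply/existsP; exists j; rewrite ij jk.
Qed.

Lemma rel_grading_inv g i j : (i, j) \in rho_ g -> (j, i) \in rho_ (g^-1)%g.
Proof.
move=> ij; case: rho_gr => disj cover _; case: rho_equiv => _ rho_sym _.
have /cover[h ji] : (j, i) \in rho by rewrite rho_sym; apply/cover; exists g.
(* The composite [(i, i)] lies in [rho_ (g * h)] and also in [rho_ 1]; disjointness leaves only
   [g * h = 1]. *)
have [gh1|/disj /disjointFr dis] := eqVneq (g * h)%g 1%g.
  by rewrite -[(g^-1)%g]mulg1 -gh1 mulKg.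
by have := dis _ (rel_grading_mul ij ji); rewrite rho_1 eqxx.
Qed.

Lemma rel_grading_functional g i j k :
  (i, j) \in rho_ g -> (i, k) \in rho_ g -> j = k.
Proof.
move=> /rel_grading_inv ji ik; apply/eqP; rewrite -rho_1 -(mulVg g).
exact: rel_grading_mul ji ik.
Qed.

Lemma rel_grading_injective g i j k :
  (i, k) \in rho_ g -> (j, k) \in rho_ g -> i = j.
Proof.
move=> ik /rel_grading_inv kj; apply/eqP; rewrite -rho_1 -(mulgV g).
exact: rel_grading_mul ik kj.
Qed.

(** This is the left identity law for epsilon. If [k] is the partner of [i] under [rho_ g], row [i]
    of [M] is moved to row [k] and back; a row without a partner is zero in [M]. *)
Lemma relindKl (R : nzRingType) g (M : 'M[R]_n) : relmx R (rho_ g) M ->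
  relind R (rho_ g) *m (relind R (rho_ (g^-1)%g) *m M) = M.
Proof.
move=> /relmxP M0; apply/matrixP => i j.
have [/existsP[k ik]|/existsPn noi] := boolP [exists k, (i, k) \in rho_ g].
  have ki := rel_grading_inv ik.
  rewrite (@relind_mull _ _ _ _ _ k) // => [|l il].
    rewrite (@relind_mull _ _ _ _ _ i) // => l kl.
    exact: rel_grading_functional kl ki.
  exact: rel_grading_functional il ik.
by rewrite relind_mull0 // M0.
Qed.

(** The same argument on columns gives the right identity law. *)
Lemma relindKr (R : nzRingType) g (M : 'M[R]_n) : relmx R (rho_ g) M ->
  M *m relind R (rho_ (g^-1)%g) *m relind R (rho_ g) = M.
Proof.
move=> /relmxP M0; apply/matrixP => i j.
have [/existsP[k kj]|/existsPn noj] := boolP [exists k, (k, j) \in rho_ g].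
  have jk := rel_grading_inv kj.
  rewrite (@relind_mulr _ _ _ _ _ k) // => [|l lj].
    rewrite (@relind_mulr _ _ _ _ _ j) // => l lk.
    exact: rel_grading_injective lk jk.
  exact: rel_grading_injective lj kj.
by rewrite relind_mulr0 // M0.
Qed.

End PartialBijections.

(** Two test matrices suffice, as [1 != 0] in [R]: [relind X] must be diagonal, and the identity
    matrix must be supported on [X]. *)
Lemma relmx_diagmx (R : nzRingType) n (X : {set 'I_n * 'I_n}) :
  relmx R X = diagmx R n -> forall i j, ((i, j) \in X) = (i == j).
Proof.
move=> XD i j; apply/idP/eqP => [ijX|<-{j}].
  apply/eqP; apply: contraT => ij.
  have : diagmx R n (relind R X) by rewrite -XD; apply: relmx_relind.
  by move=> /diagmxP /(_ _ _ ij) /eqP; rewrite mxE ijX oner_eq0.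
apply: contraT => iiX; have : relmx R X 1%:M.
  by rewrite XD; apply/diagmxP => k l /negbTE kl; rewrite mxE kl.
by move=> /relmxP /(_ _ _ iiX) /eqP; rewrite mxE eqxx oner_eq0.
Qed.

Theorem corollary35 (R : nzRingType) (n : nat) (n_gt0 : (0 < n)%N)
    (G : groupType) (rho : {set 'I_n * 'I_n}) (rho_equiv : is_equiv_on rho)
    (S : G -> set 'M[R]_n) (S_vgood : is_very_good_grading rho S)
    (S_e : S 1%g = diagmx R n) :
  is_epsilon_crossed_product (relmx R rho) S.
Proof.
have [S_gr [rho_ [rho_gr S_E]]] := S_vgood.
have rho_1 : forall i j, ((i, j) \in rho_ 1%g) = (i == j).
  by apply: (@relmx_diagmx R); rewrite -S_E.
have S_ind g : S g (relind R (rho_ g)) by rewrite S_E; apply: relmx_relind.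
split=> //; first exact: relmx_unital_subring.
exists (fun g => relind R (rho_ g) * relind R (rho_ (g^-1)%g)); split.
  split=> [g|g M].
    (* Epsilon is a single product of homogeneous elements, hence already a generator. *)
    apply: sub_gen_smallest; exists (relind R (rho_ g)) => //.
    by exists (relind R (rho_ (g^-1)%g)).
  rewrite S_E invgK => gM.
  split; first by rewrite -mulrA; exact: (relindKl rho_equiv rho_gr rho_1 gM).
  by rewrite mulrA; exact: (relindKr rho_equiv rho_gr rho_1 gM).
move=> g; exists (relind R (rho_ g)), (relind R (rho_ (g^-1)%g)).
(* By the choice of epsilon, both equations hold as soon as the double inverse of [g] is
   simplified. *)
by rewrite invgK.
Qed.
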